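(* There is an absolute constant $c>0$ such that for every integer $n\ge 3$ there exists a set $S$ of $n$ points in $\mathbb{R}^3$ and a point $o\in S$ such that at least $c\,n^{4/3}$ triangles with vertices in $S$ have one vertex at $o$ and have area equal to the maximum area among all triangles with vertices in $S$.
   Context: A triangle spanned by $S$ is an unordered triple of points of $S$. *)

(* Defs.v *)
From mathcomp Require Import all_boot all_order all_algebra finmap.
From mathcomp Require Import ring.
From mathcomp Require Import reals exp.

Set Implicit Arguments.
Unset Strict Implicit.
Unset Printing Implicit Defensive.

Import Order.TTheory GRing.Theory Num.Theory.

Local Open Scope fset_scope.
Local Open Scope ring_scope.

Section Triangles.
Variable R : realType.
Implicit Types (a b c u v : 'rV[R]_3) (S t : {fset 'rV[R]_3}).

(* The norm that the library puts on row vectors is the sup norm. *)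
Definition enorm u : R := Num.sqrt (\sum_(i < 3) u 0 i ^+ 2).

(* Indices are added modulo 3. *)
Definition crossmul u v : 'rV[R]_3 :=
  \row_(i < 3) (u 0 (i + 1) * v 0 (i + 2%:R) - u 0 (i + 2%:R) * v 0 (i + 1)).

Definition area a b c : R := enorm (crossmul (b - a) (c - a)) / 2%:R.

Definition triangles S : {fset {fset 'rV[R]_3}} :=
  [fset t in fpowerset S | #|` t| == 3].

(* The three vertices are read off the enumeration of t; their order does not
   matter, see triangle_area3. *)
Definition triangle_area t : R := area t`_0 t`_1 t`_2.

(* Areas are nonnegative, so the default value 0 does not affect the maximum. *)
Definition max_area S : R :=
  \big[Order.max/0]_(t <- triangles S) triangle_area t.

Definition max_area_triangles_at S (o : 'rV[R]_3) : {fset {fset 'rV[R]_3}} :=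
  [fset t in triangles S | (o \in t) && (triangle_area t == max_area S)].

Lemma crossmulE u v :
  [/\ crossmul u v 0 0 = u 0 1 * v 0 2%:R - u 0 2%:R * v 0 1,
      crossmul u v 0 1 = u 0 2%:R * v 0 0 - u 0 0 * v 0 2%:R
    & crossmul u v 0 2%:R = u 0 0 * v 0 1 - u 0 1 * v 0 0].
Proof.
by split; rewrite mxE; congr (u 0 _ * v 0 _ - u 0 _ * v 0 _); apply: val_inj.
Qed.

Lemma areaE a b c : area a b c = Num.sqrt (
    ((b 0 1 - a 0 1) * (c 0 2%:R - a 0 2%:R)
     - (b 0 2%:R - a 0 2%:R) * (c 0 1 - a 0 1)) ^+ 2
  + ((b 0 2%:R - a 0 2%:R) * (c 0 0 - a 0 0)
     - (b 0 0 - a 0 0) * (c 0 2%:R - a 0 2%:R)) ^+ 2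
  + ((b 0 0 - a 0 0) * (c 0 1 - a 0 1)
     - (b 0 1 - a 0 1) * (c 0 0 - a 0 0)) ^+ 2) / 2%:R.
Proof.
rewrite /area /enorm; set w := crossmul _ _.
have -> : \sum_(i < 3) w 0 i ^+ 2 = w 0 0 ^+ 2 + w 0 1 ^+ 2 + w 0 2%:R ^+ 2.
  rewrite !big_ord_recl big_ord0 addr0 addrA.
  by congr (w 0 _ ^+ 2 + w 0 _ ^+ 2 + w 0 _ ^+ 2); apply: val_inj.
by have [-> -> ->] := crossmulE (b - a) (c - a); rewrite !mxE.
Qed.

Lemma area_swap23 a b c : area a b c = area a c b.
Proof. by rewrite !areaE; congr (Num.sqrt _ / _); ring. Qed.

Lemma area_swap12 a b c : area a b c = area b a c.
Proof. by rewrite !areaE; congr (Num.sqrt _ / _); ring. Qed.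

Lemma triangle_area3 a b c : a != b -> a != c -> b != c ->
  triangle_area [fset a; b; c] = area a b c.
Proof.
move=> ab ac bc; rewrite /triangle_area.
have: perm_eq (enum_fset [fset a; b; c]) [:: a; b; c].
  apply: uniq_perm; first exact: fset_uniq.
    by rewrite /= !inE negb_or ab ac bc.
  by move=> x; rewrite !inE orbA.
case: (enum_fset _) => [|x [|y [|z [|w s]]]] /[dup] /perm_size //= _ p.
have := perm_uniq p; rewrite /= !inE !negb_or ab ac bc /= => /and3P[/andP[xy xz] yz _].
have mem u : u \in [:: x; y; z] -> [\/ u = a, u = b | u = c].
  rewrite (perm_mem p) !inE => /or3P[]/eqP->;
    [exact: Or31|exact: Or32|exact: Or33].
have [] := mem x; rewrite ?inE ?eqxx // => ex;
have [] := mem y; rewrite ?inE ?eqxx ?orbT // => ey;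
have [] := mem z; rewrite ?inE ?eqxx ?orbT // => ez;
  move: xy xz yz; rewrite ex ey ez ?eqxx // => _ _ _.
- by rewrite area_swap23.
- by rewrite area_swap12.
- by rewrite area_swap23 area_swap12.
- by rewrite area_swap12 area_swap23.
- by rewrite area_swap12 area_swap23 area_swap12.
Qed.

End Triangles.

(* Main.v *)
Require Import Defs.
From mathcomp Require Import all_boot all_order all_algebra finmap.
From mathcomp Require Import zify ring lra.
From mathcomp Require Import reals exp.

Import Order.TTheory GRing.Theory Num.Theory.

Local Open Scope fset_scope.
Local Open Scope ring_scope.

(** Take [o] to be the origin and all other points on the unit sphere, in two
    small clusters around the basis vectors [e1] and [e2].  A triangle with two
    vertices in one cluster is too thin to have area above 1/2, and a triangle
    formed by [o] and one point [a], [b] of each cluster has area at most 1/2,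
    with equality iff [a] and [b] are orthogonal.  Normalizing [(1, x, y)] and
    [(- m, 1, v)], orthogonality reads [m = x + y * v]: it is the incidence of
    the point [(y, x)] with the line of slope [- v] and intercept [m].  So the
    Elekes grid [x = p e^2], [y = j e], [m = q e^2], [v = i e], with [i, j < k],
    [p < k^2] and [q < 2 k^2 - 1], has about [3 k^3] points and [k^4] triangles
    of maximum area, one for each [(p, j, i)], with [q = p + j i]. *)

Section Construction.
Variable R : realType.
Implicit Types (a b u v w : 'rV[R]_3) (x y : R) (S : {fset 'rV[R]_3}).

(** * Area bounds from squared side lengths *)

Definition sqnorm u : R := u 0 0 ^+ 2 + u 0 1 ^+ 2 + u 0 2%:R ^+ 2.

Lemma sqnorm_ge0 u : 0 <= sqnorm u.
Proof. by rewrite !addr_ge0 ?sqr_ge0. Qed.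

(** By Lagrange's identity, the squared norm of a cross product is the product of the squared norms
    minus the squared inner product. *)
Lemma area_le_half u v w :
  sqnorm (v - u) * sqnorm (w - u) <= 1 -> area u v w <= 2^-1.
Proof.
move=> h; rewrite areaE -[leRHS]mul1r ler_pM2r ?invr_gt0 ?ltr0n //.
rewrite -[leRHS]sqrtr1 ler_wsqrtr //; apply: le_trans h.
rewrite /sqnorm !mxE -subr_ge0.
set a1 := v 0 0 - u 0 0; set a2 := v 0 1 - u 0 1; set a3 := v 0 _ - u 0 _.
set b1 := w 0 0 - u 0 0; set b2 := w 0 1 - u 0 1; set b3 := w 0 _ - u 0 _.
apply: le_trans (sqr_ge0 (a1 * b1 + a2 * b2 + a3 * b3)) _.
by rewrite le_eqVlt; apply/orP; left; apply/eqP; ring.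
Qed.

(** Equality case of Lagrange's identity: the inner product vanishes, so the cross product of the
    two unit vectors has norm 1. *)
Lemma area_origin u v :
  sqnorm u = 1 -> sqnorm v = 1 ->
  u 0 0 * v 0 0 + u 0 1 * v 0 1 + u 0 2%:R * v 0 2%:R = 0 ->
  area 0 u v = 2^-1.
Proof.
rewrite /sqnorm => hu hv huv; rewrite areaE !mxE !subr0 -[RHS]mul1r.
congr (_ / _); rewrite -[RHS]sqrtr1; congr Num.sqrt.
have : (u 0 0 * v 0 0 + u 0 1 * v 0 1 + u 0 2%:R * v 0 2%:R) ^+ 2 = 0.
  by rewrite huv expr0n.
have : (u 0 0 ^+ 2 + u 0 1 ^+ 2 + u 0 2%:R ^+ 2) *
       (v 0 0 ^+ 2 + v 0 1 ^+ 2 + v 0 2%:R ^+ 2) = 1 by rewrite hu hv mulr1.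
by move: (u 0 0) (u 0 1) (u 0 2%:R) (v 0 0) (v 0 1) (v 0 2%:R) => a b c d e f *; lra.
Qed.

(** * Two clusters on the unit sphere *)

Definition near_e1 u := [/\ sqnorm u = 1, 5 / 6 <= u 0 0,
  `|u 0 1| <= 6^-1 & `|u 0 2%:R| <= 6^-1].

Definition near_e2 u := [/\ sqnorm u = 1, 5 / 6 <= u 0 1,
  `|u 0 0| <= 6^-1 & `|u 0 2%:R| <= 6^-1].

Lemma sqr_dist_le (l h x y : R) :
  l <= x <= h -> l <= y <= h -> (y - x) ^+ 2 <= (h - l) ^+ 2.
Proof. by move=> /andP[? ?] /andP[? ?]; nra. Qed.

Lemma sqr_sum_le1 x y (z : R) : x ^+ 2 + y ^+ 2 + z ^+ 2 = 1 -> x <= 1.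
Proof. by move=> h; have := sqr_ge0 y; have := sqr_ge0 z; nra. Qed.

(** The large coordinates lie in [[5/6, 1]] and the small ones in [[-1/6, 1/6]], which gives
    [1/36 + 1/9 + 1/9 = 1/4]. *)
Lemma near_e1_sqdist u v : near_e1 u -> near_e1 v -> sqnorm (v - u) <= 4^-1.
Proof.
rewrite /near_e1 /sqnorm !mxE !ler_norml => -[/sqr_sum_le1 hu u0 u1 u2].
move=> -[/sqr_sum_le1 hv v0 v1 v2].
have := sqr_dist_le _ _ _ _ u1 v1; have := sqr_dist_le _ _ _ _ u2 v2.
have := sqr_dist_le (5 / 6) 1 (u 0 0) (v 0 0); rewrite u0 v0 hu hv.
by move=> /(_ isT isT); lra.
Qed.

Lemma near_e2_sqdist u v : near_e2 u -> near_e2 v -> sqnorm (v - u) <= 4^-1.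
Proof.
rewrite /near_e2 /sqnorm !mxE [_ + u 0 1 ^+ 2]addrC [_ + v 0 1 ^+ 2]addrC.
rewrite !ler_norml => -[/sqr_sum_le1 hu u0 u1 u2] -[/sqr_sum_le1 hv v0 v1 v2].
have := sqr_dist_le _ _ _ _ u1 v1; have := sqr_dist_le _ _ _ _ u2 v2.
have := sqr_dist_le (5 / 6) 1 (u 0 1) (v 0 1); rewrite u0 v0 hu hv.
by move=> /(_ isT isT); lra.
Qed.

Lemma sqdist_le4 u v : sqnorm u <= 1 -> sqnorm v <= 1 -> sqnorm (v - u) <= 4.
Proof.
rewrite /sqnorm !mxE.
move: (u 0 0) (u 0 1) (u 0 2%:R) (v 0 0) (v 0 1) (v 0 2%:R) => a b c d e f *.
(* Parallelogram law: [|v - u|^2 = 2|u|^2 + 2|v|^2 - |u + v|^2]. *)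
have := sqr_ge0 (a + d); have := sqr_ge0 (b + e); have := sqr_ge0 (c + f).
by lra.
Qed.

Definition clustered u := [\/ u = 0, near_e1 u | near_e2 u].

Lemma sqnorm0 : sqnorm 0 = 0.
Proof. by rewrite /sqnorm !mxE expr0n !addr0. Qed.

Lemma clustered_sqnorm u : clustered u -> sqnorm u <= 1.
Proof. by case=> [->|[-> *]|[-> *]]; rewrite ?sqnorm0 ?ler01. Qed.

Lemma area_close u v w : sqnorm (v - u) <= 4^-1 ->
  clustered u -> clustered w -> area u v w <= 2^-1.
Proof.
move=> huv /clustered_sqnorm hu /clustered_sqnorm hw; apply: area_le_half.
have h := sqdist_le4 _ _ hu hw.
rewrite (le_trans (ler_pM (sqnorm_ge0 _) (sqnorm_ge0 _) huv h)) //.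
by rewrite mulVf ?pnatr_eq0.
Qed.

Lemma area_at_origin u v : clustered u -> clustered v -> area 0 u v <= 2^-1.
Proof.
move=> /clustered_sqnorm hu /clustered_sqnorm hv; apply: area_le_half.
rewrite !subr0; exact: mulr_ile1 (sqnorm_ge0 _) (sqnorm_ge0 _) hu hv.
Qed.

(** Pigeonhole: either some vertex is the origin, or two of the three vertices share a cluster. The
    swaps move that vertex or pair to the front. *)
Lemma area_clustered u v w :
  clustered u -> clustered v -> clustered w -> area u v w <= 2^-1.
Proof.
move=> cu cv cw.
case: (cu) => [->|nu|nu]; first exact: area_at_origin.
  case: (cv) => [->|nv|nv]; first by rewrite area_swap12 area_at_origin.
    by apply: area_close => //; exact: near_e1_sqdist.
  case: (cw) => [->|nw|nw].
  - by rewrite area_swap23 area_swap12 area_at_origin.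
  - by rewrite area_swap23 area_close //; exact: near_e1_sqdist.
  - by rewrite area_swap12 area_swap23 area_close //; exact: near_e2_sqdist.
case: (cv) => [->|nv|nv]; first by rewrite area_swap12 area_at_origin.
  case: (cw) => [->|nw|nw].
  - by rewrite area_swap23 area_swap12 area_at_origin.
  - by rewrite area_swap12 area_swap23 area_close //; exact: near_e1_sqdist.
  - by rewrite area_swap23 area_close //; exact: near_e2_sqdist.
by apply: area_close => //; exact: near_e2_sqdist.
Qed.

Lemma triangle_area_clustered S t :
  {in S, forall u, clustered u} -> t \in triangles S -> triangle_area t <= 2^-1.
Proof.
move=> hS; rewrite !inE /= fpowersetE => /andP[/fsubsetP tS /eqP t3].
by apply: area_clustered; apply/hS/tS/mem_nth; rewrite t3.
Qed.

Lemma triangles3 S u v w : u \in S -> v \in S -> w \in S ->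
  u != v -> u != w -> v != w -> [fset u; v; w] \in triangles S.
Proof.
move=> uS vS wS uv uw vw; rewrite !inE /= fpowersetE; apply/andP; split.
  by apply/fsubsetP => x; rewrite !inE => /orP[/orP[]|] /eqP->.
by rewrite -fsetUA !cardfsU1 cardfs1 !inE negb_or uv uw vw.
Qed.

Lemma max_area_clustered S t : {in S, forall u, clustered u} ->
  t \in triangles S -> triangle_area t = 2^-1 -> max_area S = 2^-1.
Proof.
move=> hS tS ht; apply/le_anti/andP; split; rewrite /max_area.
  rewrite big_seq; apply: bigmax_le; first by rewrite invr_ge0 ler0n.
  by move=> s sS; exact: triangle_area_clustered hS sS.
by rewrite -ht; apply: le_bigmax_seq.
Qed.

(** * Normalized points of the two clusters *)

Definition vec3 x y (z : R) : 'rV[R]_3 := \row_i [:: x; y; z]`_i.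

(** The vectors [(1, x, y)] and [(- x, 1, y)] have the same norm, so one factor serves both
    clusters. *)
Definition normalizer x y : R := (Num.sqrt (1 + x ^+ 2 + y ^+ 2))^-1.

Definition pointA x y := normalizer x y *: vec3 1 x y.
Definition pointB x y := normalizer x y *: vec3 (- x) 1 y.

Lemma pointAE x y : [/\ pointA x y 0 0 = normalizer x y,
  pointA x y 0 1 = normalizer x y * x & pointA x y 0 2%:R = normalizer x y * y].
Proof. by rewrite !mxE mulr1. Qed.

Lemma pointBE x y : [/\ pointB x y 0 0 = - (normalizer x y * x),
  pointB x y 0 1 = normalizer x y & pointB x y 0 2%:R = normalizer x y * y].
Proof. by rewrite !mxE mulr1 mulrN. Qed.

Lemma normalizer_gt0 x y : 0 < normalizer x y.
Proof. by rewrite invr_gt0 sqrtr_gt0 -addrA ltr_wpDr ?addr_ge0 ?sqr_ge0. Qed.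

Lemma normalizer_sqr x y : normalizer x y ^+ 2 * (1 + x ^+ 2 + y ^+ 2) = 1.
Proof.
have h : 0 < 1 + x ^+ 2 + y ^+ 2.
  by rewrite -addrA ltr_wpDr ?addr_ge0 ?sqr_ge0.
by rewrite exprVn sqr_sqrtr ?ltW // mulVf ?gt_eqF.
Qed.

Lemma normalizer_near x y : 0 <= x <= 6^-1 -> 0 <= y <= 6^-1 ->
  [/\ 5 / 6 <= normalizer x y, 0 <= normalizer x y * x <= 6^-1
    & 0 <= normalizer x y * y <= 6^-1].
Proof.
have := normalizer_gt0 x y; have := normalizer_sqr x y.
move: (normalizer x y) => s hs s0 /andP[x0 x6] /andP[y0 y6].
have s1 : s <= 1 by nra.
by split; nra.
Qed.

Lemma pointA_near x y : 0 <= x <= 6^-1 -> 0 <= y <= 6^-1 -> near_e1 (pointA x y).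
Proof.
move=> hx hy; have [h1 /andP[h2 h3] /andP[h4 h5]] := normalizer_near _ _ hx hy.
rewrite /near_e1 /sqnorm; have [-> -> ->] := pointAE x y.
by rewrite !ger0_norm //; split=> //; rewrite -(normalizer_sqr x y); ring.
Qed.

Lemma pointB_near x y : 0 <= x <= 6^-1 -> 0 <= y <= 6^-1 -> near_e2 (pointB x y).
Proof.
move=> hx hy; have [h1 /andP[h2 h3] /andP[h4 h5]] := normalizer_near _ _ hx hy.
rewrite /near_e2 /sqnorm; have [-> -> ->] := pointBE x y.
by rewrite normrN !ger0_norm //; split=> //; rewrite -(normalizer_sqr x y); ring.
Qed.

(** The coordinate 0 is the normalizer itself; once the normalizers agree, they cancel from the
    other two coordinates. *)
Lemma pointA_inj x y x' y' : pointA x y = pointA x' y' -> x = x' /\ y = y'.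
Proof.
move=> e; have [e0 e1 e2] := pointAE x y; have [e0' e1' e2'] := pointAE x' y'.
move: e0' e1' e2'; rewrite -e e0 e1 e2 => <-.
by have /lt0r_neq0 s0 := normalizer_gt0 x y; move=> /(mulfI s0)? /(mulfI s0).
Qed.

Lemma pointB_inj x y x' y' : pointB x y = pointB x' y' -> x = x' /\ y = y'.
Proof.
move=> e; have [e1 e0 e2] := pointBE x y; have [e1' e0' e2'] := pointBE x' y'.
move: e0' e1' e2'; rewrite -e e0 e1 e2 => <- /oppr_inj.
by have /lt0r_neq0 s0 := normalizer_gt0 x y; move=> /(mulfI s0)? /(mulfI s0).
Qed.

Lemma pointA_neq0 x y : pointA x y != 0.
Proof.
apply/eqP => e; have [] := pointAE x y; rewrite e mxE => h _ _.
by have := normalizer_gt0 x y; rewrite -h ltxx.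
Qed.

Lemma pointB_neq0 x y : pointB x y != 0.
Proof.
apply/eqP => e; have [] := pointBE x y; rewrite e !mxE => _ h _.
by have := normalizer_gt0 x y; rewrite -h ltxx.
Qed.

(** The sign of coordinate 0 separates the clusters: positive on the left, nonpositive on the
    right. *)
Lemma pointA_neqB x y x' y' : 0 <= x' -> pointA x y != pointB x' y'.
Proof.
move=> x0; apply/eqP => e; have [h _ _] := pointAE x y.
have [h' _ _] := pointBE x' y'; have := normalizer_gt0 x y.
rewrite -h e h' oppr_gt0 ltNge mulr_ge0 //; exact/ltW/normalizer_gt0.
Qed.

Lemma area_pointAB x y x' y' : x' = x + y * y' ->
  0 <= x <= 6^-1 -> 0 <= y <= 6^-1 -> 0 <= x' <= 6^-1 -> 0 <= y' <= 6^-1 ->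
  area 0 (pointA x y) (pointB x' y') = 2^-1.
Proof.
move=> e hx hy hx' hy'; have [nA _ _ _] := pointA_near _ _ hx hy.
have [nB _ _ _] := pointB_near _ _ hx' hy'; apply: area_origin => //.
have [-> -> ->] := pointAE x y; have [-> -> ->] := pointBE x' y'.
by rewrite e; ring.
Qed.

(** * The grid configuration and its triangles of maximum area *)

Section Grid.
Variables (k r : nat) (e : R).

Definition pairs (m l : nat) : seq (nat * nat) :=
  [seq (p, j) | p <- iota 0 m, j <- iota 0 l].

Lemma mem_pairs m l p j : ((p, j) \in pairs m l) = (p < m)%N && (j < l)%N.
Proof.
apply/allpairsP/idP => [[[x y] /= []]|/andP[pm jl]].
  by rewrite !mem_iota /= !add0n => xm yl [-> ->]; rewrite xm.
by exists (p, j); rewrite !mem_iota.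
Qed.

Lemma pairs_uniq m l : uniq (pairs m l).
Proof.
apply: allpairs_uniq; [exact: iota_uniq|exact: iota_uniq|].
by move=> [? ?] [? ?] _ _ [-> ->].
Qed.

Lemma size_pairs m l : size (pairs m l) = (m * l)%N.
Proof. by rewrite size_allpairs !size_iota. Qed.

(* The second part only pads the configuration to the prescribed size. *)
Definition idxA := pairs (k ^ 2) k ++ [seq (p, k) | p <- iota 0 r].
Definition idxB := pairs (2 * k ^ 2 - 1) k.
Definition idxT : seq (nat * nat * nat) :=
  [seq (pj, i) | pj <- pairs (k ^ 2) k, i <- iota 0 k].

Lemma mem_idxA p j : ((p, j) \in idxA) =
  (p < k ^ 2)%N && (j < k)%N || (p < r)%N && (j == k).
Proof.
rewrite mem_cat mem_pairs; congr (_ || _).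
apply/mapP/andP => [[x]|[pr /eqP->]]; last by exists p; rewrite ?mem_iota.
by rewrite mem_iota => /= xr [-> ->].
Qed.

Lemma mem_idxT p j i :
  ((p, j, i) \in idxT) = [&& (p < k ^ 2)%N, (j < k)%N & (i < k)%N].
Proof.
rewrite andbA -mem_pairs; apply/allpairsP/idP => [[[x y] /= []]|/andP[pm jl]].
  by rewrite mem_iota /= add0n => xm yl [-> ->]; rewrite xm.
by exists ((p, j), i); rewrite mem_iota.
Qed.

Lemma idxA_uniq : uniq idxA.
Proof.
rewrite cat_uniq pairs_uniq map_inj_uniq ?iota_uniq ?andbT => [/=|x y []//].
by apply/hasPn => -[p j] /mapP[x _ [-> ->]]; rewrite mem_pairs ltnn andbF.
Qed.

Lemma idxT_uniq : uniq idxT.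
Proof.
apply: allpairs_uniq; [exact: pairs_uniq|exact: iota_uniq|].
by move=> [? ?] [? ?] _ _ [-> ->].
Qed.

(** With weights [e ^+ 2] and [e], the relation [x' = x + y * y'] is homogeneous and becomes
    [q = p + j * i] on indices, whatever the nonzero scale [e]. *)
Definition gridA (pj : nat * nat) := pointA (pj.1%:R * e ^+ 2) (pj.2%:R * e).
Definition gridB (qi : nat * nat) := pointB (qi.1%:R * e ^+ 2) (qi.2%:R * e).
Definition gridT (t : nat * nat * nat) : {fset 'rV[R]_3} :=
  [fset 0; gridA t.1; gridB (t.1.1 + t.1.2 * t.2, t.2)%N].

Definition grid_set : {fset 'rV[R]_3} :=
  [fset u in 0 :: map gridA idxA ++ map gridB idxB].

Variable n : nat.
Hypothesis k_gt0 : (0 < k)%N.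
Hypothesis nE : n = (1 + (k ^ 3 + r) + (2 * k ^ 2 - 1) * k)%N.
(** All indices, padding included, are at most [n], so this scale keeps every coordinate parameter
    within [[0, 1/6]]. *)
Hypothesis eE : e = (6 * n%:R)^-1.

Let n_gt0 : (0 < n)%N. Proof. by rewrite nE. Qed.
Let e_gt0 : 0 < e. Proof. by rewrite eE invr_gt0 mulr_gt0 ?ltr0n. Qed.

Lemma scale_small p : (p <= n)%N -> 0 <= p%:R * e <= 6^-1.
Proof.
move=> pn; rewrite mulr_ge0 ?(ltW e_gt0) //= eE.
by rewrite ler_pdivrMr ?mulr_gt0 ?ltr0n // mulKf ?pnatr_eq0 // ler_nat.
Qed.

Lemma scale_sqr_small p : (p <= n)%N -> 0 <= p%:R * e ^+ 2 <= 6^-1.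
Proof.
(* The instance [p = 1] of [scale_small] gives [e <= 1/6], so the extra factor [e] only shrinks
   [p%:R * e]. *)
move=> /scale_small; have /andP[] := scale_small _ n_gt0.
by rewrite mul1r => e0 e6 /andP[p0 p6]; nra.
Qed.

Lemma idxA_le p j : (p, j) \in idxA -> (p <= n)%N && (j <= n)%N.
Proof.
by rewrite mem_idxA nE => /orP[/andP[? ?]|/andP[? /eqP ->]]; apply/andP; split; nia.
Qed.

Lemma idxB_le q i : (q, i) \in idxB -> (q <= n)%N && (i <= n)%N.
Proof. by rewrite mem_pairs nE => /andP[? ?]; apply/andP; split; nia. Qed.

Lemma gridA_near pj : pj \in idxA -> near_e1 (gridA pj).
Proof.
case: pj => p j /idxA_le/andP[pn jn].
by apply: pointA_near; [exact: scale_sqr_small|exact: scale_small].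
Qed.

Lemma gridB_near qi : qi \in idxB -> near_e2 (gridB qi).
Proof.
case: qi => q i /idxB_le/andP[qn jn].
by apply: pointB_near; [exact: scale_sqr_small|exact: scale_small].
Qed.

Lemma scale_inj (c : R) (p q : nat) : 0 < c -> p%:R * c = q%:R * c -> p = q.
Proof. by move=> /lt0r_neq0 c0 /(mulIf c0)/eqP; rewrite eqr_nat => /eqP. Qed.

Lemma gridA_inj : injective gridA.
Proof.
move=> [p j] [p' j'] /pointA_inj[/= /scale_inj h1 /scale_inj h2].
by rewrite h1 ?exprn_gt0 // h2.
Qed.

Lemma gridB_inj : injective gridB.
Proof.
move=> [p j] [p' j'] /pointB_inj[/= /scale_inj h1 /scale_inj h2].
by rewrite h1 ?exprn_gt0 // h2.
Qed.

Lemma gridA_neqB pj qi : gridA pj != gridB qi.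
Proof. by apply: pointA_neqB; rewrite mulr_ge0 ?ler0n ?exprn_ge0 ?ltW. Qed.

Lemma mem_grid_set u : (u \in grid_set) =
  [|| u == 0, u \in map gridA idxA | u \in map gridB idxB].
Proof. by rewrite in_fset inE mem_cat. Qed.

Lemma grid_set_clustered : {in grid_set, forall u, clustered u}.
Proof.
move=> u; rewrite mem_grid_set => /or3P[/eqP->|/mapP[x xA ->]|/mapP[x xB ->]].
- exact: Or31.
- exact/Or32/gridA_near.
- exact/Or33/gridB_near.
Qed.

Lemma card_grid_set : #|` grid_set| = n.
Proof.
rewrite card_fseq undup_id.
  by rewrite /= !(size_cat, size_map) !size_pairs size_iota nE; nia.
rewrite /= mem_cat negb_or cat_uniq !map_inj_uniq ?idxA_uniq ?pairs_uniq ?andbT /=.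
- rewrite -?andbA; apply/and3P; split.
  + by apply/mapP => -[x _ /esym/eqP]; apply/negP/pointA_neq0.
  + by apply/mapP => -[x _ /esym/eqP]; apply/negP/pointB_neq0.
  + apply/hasPn => u /mapP[x _ ->]; apply/mapP => -[y _ /esym/eqP].
    by apply/negP/gridA_neqB.
- exact: gridB_inj.
- exact: gridA_inj.
Qed.

Lemma idxT_vertices p j i : (p, j, i) \in idxT ->
  (p, j) \in idxA /\ (p + j * i, i)%N \in idxB.
Proof.
rewrite mem_idxT mem_idxA mem_pairs => /and3P[pk jk ik]; rewrite pk jk ik andbT.
(* Hence [p + j * i <= (k^2 - 1) + (k - 1)^2 = 2k^2 - 2k], which is below the bound [2k^2 - 1] of
   [idxB]. *)
have : (j * i <= k.-1 * k.-1)%N by apply: leq_mul; lia.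
by move: k_gt0 pk; case: (k) => // m _; rewrite /= !expnS expn0; split=> //; lia.
Qed.

Lemma gridT_triangle t : t \in idxT -> gridT t \in triangles grid_set.
Proof.
case: t => [[p j] i] /idxT_vertices[hA hB].
apply: triangles3; rewrite ?mem_grid_set ?eqxx ?map_f ?orbT //.
- by rewrite eq_sym pointA_neq0.
- by rewrite eq_sym pointB_neq0.
- exact: gridA_neqB.
Qed.

Lemma gridT_area t : t \in idxT -> triangle_area (gridT t) = 2^-1.
Proof.
case: t => [[p j] i] /idxT_vertices[hA hB]; rewrite triangle_area3.
- have /andP[pn jn] := idxA_le _ _ hA; have /andP[qn i_n] := idxB_le _ _ hB.
  apply: area_pointAB; try exact: scale_small; try exact: scale_sqr_small.
  by rewrite /= natrD natrM; ring.
- by rewrite eq_sym pointA_neq0.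
- by rewrite eq_sym pointB_neq0.
- exact: gridA_neqB.
Qed.

(** The origin, the A-points and the B-points are pairwise distinct, so the vertex set determines
    its A-vertex, hence [(p, j)], and its B-vertex, hence [i]. *)
Lemma gridT_inj : injective gridT.
Proof.
move=> [[p j] i] [[p' j'] i'] h.
have : gridA (p, j) \in gridT (p', j', i') by rewrite -h !inE eqxx orbT.
rewrite !inE (negPf (pointA_neq0 _ _)) (negPf (gridA_neqB _ _)) orbF /=.
move=> /eqP/gridA_inj <-.
have : gridB (p + j * i, i)%N \in gridT (p', j', i') by rewrite -h !inE eqxx orbT.
rewrite !inE (negPf (pointB_neq0 _ _)) eq_sym (negPf (gridA_neqB _ _)) /=.
by move=> /eqP/gridB_inj[_ <-].
Qed.

Lemma max_area_grid_set : max_area grid_set = 2^-1.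
Proof.
(* One triangle of area 1/2 suffices to fix the maximum; [k > 0] provides it. *)
have t0 : (0, 0, 0)%N \in idxT by rewrite mem_idxT expn_gt0 k_gt0.
apply: max_area_clustered grid_set_clustered (gridT_triangle _ t0) _.
exact: gridT_area.
Qed.

Lemma card_max_grid_set : (k ^ 4 <= #|` max_area_triangles_at grid_set 0|)%N.
Proof.
have -> : (k ^ 4 = size (map gridT idxT))%N.
  by rewrite size_map size_allpairs size_pairs size_iota -!expnSr.
apply: uniq_leq_size; first by rewrite map_inj_uniq ?idxT_uniq //; exact: gridT_inj.
move=> _ /mapP[t ht ->]; rewrite in_fset; apply/andP; split; first exact: gridT_triangle.
by rewrite gridT_area // max_area_grid_set !inE !eqxx.
Qed.

End Grid.

(** * Choice of the parameters and the final count *)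

Lemma grid_parameters n : (3 <= n)%N -> exists k r,
  [/\ (0 < k)%N, n = (1 + (k ^ 3 + r) + (2 * k ^ 2 - 1) * k)%N
    & (n <= 27 * k ^ 3)%N].
Proof.
move=> n3; pose P k := (1 + k ^ 3 + (2 * k ^ 2 - 1) * k <= n)%N.
(* For [k = 1] the configuration has [1 + 1 + 1 = 3] points, which is where [3 <= n] enters. *)
have P1 : exists k, P k by exists 1%N.
have Pn k : P k -> (k <= n)%N by rewrite /P; nia.
(* Take the largest grid that fits and leave the remaining points to the padding [r]. Maximality
   gives [n < 3(k + 1)^3 - k], and [k + 1 <= 2k] brings this below [24k^3]. *)
case: (ex_maxnP P1 Pn) => k Pk kmax; have k1 : (0 < k)%N by apply: kmax.
exists k, (n - (1 + k ^ 3 + (2 * k ^ 2 - 1) * k))%N; split=> //.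
  by move: Pk; rewrite /P; lia.
have : ~~ P k.+1 by apply/negP => /kmax; rewrite ltnn.
by rewrite /P -ltnNge; nia.
Qed.

End Construction.

Theorem theorem9 (R : realType) :
  exists c : R, 0 < c /\
    forall n : nat, (3 <= n)%N ->
      exists (S : {fset 'rV[R]_3}) (o : 'rV[R]_3),
        [/\ #|` S| = n, o \in S, 0 < max_area S &
            c * n%:R `^ (4%:R / 3%:R) <= #|` max_area_triangles_at S o|%:R].
Proof.
(* From [n <= 27k^3] follows [n^(4/3) <= 27^(4/3) k^4], and there are at least [k^4] maximal
   triangles at the origin. *)
exists (27 `^ (4%:R / 3%:R))^-1; split; first by rewrite invr_gt0 powR_gt0.
move=> n n3; have [k [r [k0 nE nk]]] := grid_parameters _ n3.
pose e : R := (6 * n%:R)^-1; exists (grid_set R k r e), 0; split.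
- exact: card_grid_set nE erefl.
- by rewrite mem_grid_set eqxx.
- by rewrite (max_area_grid_set _ _ _ _ _ k0 nE erefl) invr_gt0.
apply: (@le_trans _ _ (k ^ 4)%:R); last first.
  by rewrite ler_nat; exact: card_max_grid_set k0 nE erefl.
rewrite mulrC ler_pdivrMr ?powR_gt0 //.
have -> : (k ^ 4)%:R = ((k ^ 3)%:R : R) `^ (4%:R / 3%:R).
  rewrite !natrX -!powR_mulrn ?ler0n // -powRrM; congr (_ `^ _).
  by rewrite mulrC divfK ?pnatr_eq0.
rewrite [leRHS]mulrC -powRM ?ler0n // -natrM.
by apply: ge0_ler_powR; rewrite ?nnegrE ?ler_nat ?divr_ge0 ?ler0n.
Qed.
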